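(* There is an algorithm that, given a $P_4$-sparse graph $G$ with $n$ vertices, decides in $O(n)$ time whether $G$ is $2$-admissible.
   Context: All graphs are finite and simple. A tree $t$-spanner of a graph $G$ is a spanning tree $T$ of $G$ such that $d_T(u,v)\le t$ for every edge $uv$ of $G$. $G$ is $t$-admissible if it has a tree $t$-spanner. A graph is $P_4$-sparse if every set of $5$ vertices induces at most one induced path $P_4$. *)

(* Defs.v *)
From mathcomp Require Import all_boot.

Set Implicit Arguments.
Unset Strict Implicit.
Unset Printing Implicit Defensive.

(** * Graphs *)

Record sgraph (V : finType) := SGraph {
  adj :> rel V;
  adj_sym : symmetric adj;
  adj_irr : irreflexive adj }.

(* The null graph counts as connected, hence as a tree. *)
Definition is_tree (V : finType) (T : sgraph V) : Prop :=
  (forall x y : V, connect T x y) /\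
  (forall c : seq V, 2 < size c -> ~ ucycle T c).

Definition spanning_tree (V : finType) (G T : sgraph V) : Prop :=
  subrel T G /\ is_tree T.

Definition dist_le (V : finType) (G : sgraph V) (t : nat) (u v : V) : Prop :=
  exists p : seq V, [/\ path G u p, last u p = v & size p <= t].

Definition tree_spanner (V : finType) (t : nat) (G T : sgraph V) : Prop :=
  spanning_tree G T /\ (forall u v : V, G u v -> dist_le T t u v).

Definition admissible (V : finType) (t : nat) (G : sgraph V) : Prop :=
  exists T : sgraph V, tree_spanner t G T.

Definition induces_P4 (V : finType) (G : sgraph V) (X : {set V}) : bool :=
  [exists a, exists b, exists c, exists d,
    [&& X == [set a; b; c; d], uniq [:: a; b; c; d],
        G a b, G b c, G c d & [&& ~~ G a c, ~~ G a d & ~~ G b d]]].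

Definition P4_sparse (V : finType) (G : sgraph V) : Prop :=
  forall S : {set V}, #|S| = 5 ->
    #|[set X : {set V} | (X \subset S) && induces_P4 G X]| <= 1.

(** * Random access machine *)

(* Unit-cost word RAM: registers (a program mentions finitely many of them)
   and an addressable memory, both holding natural numbers.  Register names
   and jump targets are literals. *)
Inductive instr :=
| Const of nat & nat          (* Const r k   : r := k *)
| Add of nat & nat & nat      (* Add r a b   : r := a + b *)
| Sub of nat & nat & nat      (* Sub r a b   : r := a - b, truncated *)
| Fetch of nat & nat          (* Fetch r a   : r := memory[a] *)
| Store of nat & nat          (* Store a b   : memory[a] := b *)
| JumpZ of nat & nat          (* JumpZ r l   : if r = 0, go to l *)
| Halt of bool.               (* stop, answering yes or no *)

Definition program := seq instr.

Record config := Config {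
  pc : nat;
  reg : nat -> nat;
  mem : nat -> nat }.

(* Registers only ever receive words, i.e. values below W; an overflow is a
   crash, as is a jump outside the program. *)
Definition set_reg (W : nat) (s : config) (r v : nat) : option config :=
  if v < W then Some (Config (pc s).+1 [eta reg s with r |-> v] (mem s))
  else None.

Definition step (W : nat) (i : instr) (s : config) : config + option bool :=
  let R := reg s in
  let next o := if o is Some s' then inl s' else inr None in
  match i with
  | Const r k => next (set_reg W s r k)
  | Add r a b => next (set_reg W s r (R a + R b))
  | Sub r a b => next (set_reg W s r (R a - R b))
  | Fetch r a => next (set_reg W s r (mem s (R a)))
  | Store a b => inl (Config (pc s).+1 R [eta mem s with R a |-> R b])
  | JumpZ r l => inl (Config (if R r == 0 then l else (pc s).+1) R (mem s))
  | Halt b => inr (Some b)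
  end.

(* The answer given within t executed instructions; None if the machine has
   crashed or has not halted by then. *)
Fixpoint run (W : nat) (p : program) (t : nat) (s : config) : option bool :=
  if t is t'.+1 then
    if onth p (pc s) is Some i then
      match step W i s with
      | inl s' => run W p t' s'
      | inr o => o
      end
    else None
  else None.

Definition init (x : seq nat) : config :=
  Config 0 (fun=> 0) (nth 0 x).

(** * Input encoding *)

(* Adjacency lists, each listing the neighbours in an arbitrary order, stored
   consecutively behind a table of offsets (compressed sparse rows):
   cell 0 holds n, cell 1 + v (0 <= v <= n) the total length of the lists of
   the vertices smaller than v, and the list of v starts at cell
   n + 2 + offset v.  The degree of v is a difference of two table entries, so
   it is available in constant time; this is necessary for an O(n) bound, as
   the input may have quadratic length. *)
Definition offset (n : nat) (N : 'I_n -> seq 'I_n) (k : nat) : nat :=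
  \sum_(u < n | u < k) size (N u).

Definition layout (n : nat) (N : 'I_n -> seq 'I_n) : seq nat :=
  n :: [seq offset N k | k <- iota 0 n.+1]
    ++ flatten [seq [seq val w | w <- N v] | v <- enum 'I_n].

Definition encodes (n : nat) (G : sgraph 'I_n) (x : seq nat) : Prop :=
  exists2 N : 'I_n -> seq 'I_n,
    forall v, uniq (N v) /\ N v =i G v & x = layout N.

(** * Decision in linear time *)

(* Words have O(log n) bits: W = (n + 2) ^ k for a constant k.  The factor
   n + 1 only serves to allow some time when n = 0. *)
Definition decides_in_linear_time (p : program)
    (P Q : forall n : nat, sgraph 'I_n -> Prop) : Prop :=
  exists c k : nat, forall (n : nat) (G : sgraph 'I_n) (x : seq nat),
    P n G -> encodes G x ->
    exists2 b : bool,
      run (n.+2 ^ k) p (c * n.+1) (init x) = Some b & b <-> Q n G.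

(* Main.v *)
Require Import Defs.
From mathcomp Require Import all_boot.
From mathcomp Require Import zify.

Set Implicit Arguments.
Unset Strict Implicit.
Unset Printing Implicit Defensive.

(* A P4-sparse graph with n > 0 vertices, L of them leaves (vertices of degree 1),
   is 2-admissible iff it has a universal vertex or is a thin spider, and this
   shows in the degrees: either some degree is n - 1, or L > 0, n - L > 1 and
   exactly L vertices have degree n - L.
   - In a P4-sparse graph a vertex outside an induced P4 a-b-c-d sees both of b, c
     or neither, and both of a, d or neither.  Since the edges of G join vertices
     at distance at most 2 in a tree 2-spanner T, it follows that T has no path of
     length 5; so all vertices are within distance 2 of some c in T.  If no vertex
     is universal, two levels of T yield an induced P4 a-b-c-d with a a leaf of G.
     Then d is a leaf too, and by connectedness every vertex not adjacent to b is
     the end of an induced P4 starting with a, b; this gives the degrees.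
   - Conversely, the degree condition forces a vertex v such that every other
     vertex is adjacent to v or is a leaf hanging from a neighbour of v; the star
     at v together with the pendant edges is a tree 2-spanner.
   Degrees are differences of consecutive offsets, so three passes over the table
   of offsets decide. *)

(** * Induced paths *)

Lemma adj_neq (V : finType) (G : sgraph V) (u v : V) : G u v -> u != v.
Proof. by apply: contraTneq => ->; rewrite adj_irr. Qed.

Lemma card_sub_setC (T : finType) (A : {set T}) : #|T| - #|A| = #|~: A|.
Proof. by rewrite [RHS]cardsCs setCK. Qed.

Section P4Sparse.
Variables (V : finType) (G : sgraph V).

Definition P4 (a b c d : V) : bool :=
  [&& G a b, G b c, G c d & [&& ~~ G a c, ~~ G a d & ~~ G b d]].

Lemma P4_rev a b c d : P4 a b c d -> P4 d c b a.
Proof.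
case/and4P=> ab bc cd /and3P[nac nad nbd].
by apply/and4P; split; rewrite 1?adj_sym // !(adj_sym G d) (adj_sym G c) nbd nad.
Qed.

Lemma P4_uniq a b c d : P4 a b c d -> uniq [:: a; b; c; d].
Proof.
case/and4P=> ab bc cd /and3P[nac nad nbd].
have Dac : a != c by apply: contraNneq nad => ->.
have Dad : a != d by apply: contraNneq nac => ->; rewrite adj_sym.
have Dbd : b != d by apply: contraNneq nad => <-.
by rewrite /= !inE !negb_or (adj_neq ab) (adj_neq bc) (adj_neq cd) Dac Dad Dbd.
Qed.

Hypothesis sparse : P4_sparse G.

(** Otherwise the two paths have different vertex sets, as only the second contains [x], and both
    lie within the same five vertices. *)
Lemma P4_unique a b c d x p q r s :
    P4 a b c d -> x \notin [:: a; b; c; d] ->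
    P4 p q r s -> {subset [:: p; q; r; s] <= [:: a; b; c; d; x]} ->
  x \notin [:: p; q; r; s].
Proof.
move=> P Nx Q sQ; apply/negP => xQ.
pose X := [set a; b; c; d]; pose Y := [set p; q; r; s].
pose S := [set y in [:: a; b; c; d; x]].
have indP a' b' c' d' : P4 a' b' c' d' -> induces_P4 G [set a'; b'; c'; d'].
  move=> P'; apply/existsP; exists a'; apply/existsP; exists b'.
  apply/existsP; exists c'; apply/existsP; exists d'.
  by rewrite eqxx (P4_uniq P').
have cS : #|S| = 5.
  rewrite cardsE; apply: (@card_uniqP _ [:: a; b; c; d; x]).
  by rewrite (cat_uniq [:: a; b; c; d] [:: x]) (P4_uniq P) /= orbF Nx.
have := sparse cS; rewrite leqNgt => /negP; apply.
have <- : #|[set X; Y]| = 2.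
  rewrite cards2; case: eqP => // E; have: x \in Y by move: xQ; rewrite !inE -!orbA.
  by rewrite -E; move: Nx; rewrite !inE -!orbA => /negPf->.
apply: subset_leq_card; apply/subsetP => Z; rewrite !inE => /orP[] /eqP->.
  rewrite indP // andbT; apply/subsetP => y; rewrite !inE.
  by case/orP=> [/orP[/orP[]|]|] ->; rewrite ?orbT.
rewrite indP // andbT; apply/subsetP => y yY; rewrite inE; apply: sQ.
by move: yY; rewrite !inE -!orbA.
Qed.

Lemma P4_extension a b c d x :
    P4 a b c d -> x \notin [:: a; b; c; d] ->
  G x b = G x c /\ G x a = G x d.
Proof.
move=> P Nx.
have H p q r s : all (mem [:: a; b; c; d; x]) [:: p; q; r; s] ->
    x \in [:: p; q; r; s] -> P4 p q r s -> False.
  by move=> /allP sQ xQ Q; move: (P4_unique P Nx Q sQ); rewrite xQ.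
(* Each way in which [x] can violate one of the two equalities turns one of these eight quadruples,
   all through [x], into an induced path. *)
move: (H x a b c) (H x d c b) (H x b c d) (H x c b a) (H a x c d) (H d x b a)
  (H a x d c) (H d x a b).
rewrite /= !inE !eqxx !orbT /=.
case/and4P: P => ab bc cd /and3P[nac nad nbd].
rewrite /P4 !(adj_sym G _ x) (adj_sym G c b) (adj_sym G d c) (adj_sym G b a).
rewrite (adj_sym G d b) (adj_sym G c a) (adj_sym G d a).
rewrite ab bc cd (negPf nac) (negPf nad) (negPf nbd) /=.
by case: (G x a); case: (G x b); case: (G x c); case: (G x d) => //=;
  do ?[move=> /(_ isT isT isT) []|move=> _].
Qed.

(** * Leaves at the ends of induced paths *)

Definition leaf (v : V) : bool := #|G v| == 1.

Lemma leafP a b : G a b -> reflect (forall x, G a x -> x = b) (leaf a).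
Proof.
move=> ab; apply: (iffP eqP) => [/mem_card1[y Dy] x ax | H].
  by move: (Dy x) (Dy b); rewrite -!topredE /= ab ax => /esym/eqP-> /esym/eqP.
rewrite -(card1 b); apply: eq_card => x; rewrite !inE.
by apply/idP/eqP => [/H | ->].
Qed.

(** A further neighbour of [d] lies off the path, so by [P4_extension] it is adjacent to [a] as
    well, whose only neighbour is [b]. *)
Lemma P4_leaf_end a b c d : P4 a b c d -> leaf a -> leaf d.
Proof.
move=> P la; case/and4P: (P) => ab bc cd /and3P[nac nad nbd].
have Na := elimT (leafP ab) la.
have dc : G d c by rewrite adj_sym.
apply/(leafP dc) => x dx; apply: contraTeq isT => Dxc.
have Nx : x \notin [:: a; b; c; d].
  rewrite !inE (negPf Dxc) (eq_sym x d) (negPf (adj_neq dx)) !orbF negb_or.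
  by apply/andP; split; apply: contraTneq dx => ->; rewrite adj_sym.
have [_ E] := P4_extension P Nx.
have ax : G a x by rewrite adj_sym E adj_sym.
by move: Nx; rewrite (Na x ax) !inE eqxx orbT.
Qed.

Hypothesis connG : forall x y : V, connect G x y.

(** Induction along a walk from [b]. A step from a neighbour of [b] to a vertex that is neither [b]
    nor adjacent to it yields a new induced path; the far end of such a path is a leaf, so from
    there the walk can only step back. *)
Lemma leaf_P4_reach a b c d x :
  P4 a b c d -> leaf a -> [\/ x = b, G x b | exists y, P4 a b y x].
Proof.
move=> P la; case/and4P: (P) => ab bc cd /and3P[nac nad nbd].
have Na := elimT (leafP ab) la.
have /connectP[p pp ->] := connG b x; elim/last_ind: p pp => [|p z IH].
  by constructor 1.
rewrite rcons_path last_rcons => /andP[/IH {}IH]; set y := last b p in IH *.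
move=> yz; have [->|Dzb] := eqVneq z b; first by constructor 1.
have [zb|nzb] := boolP (G z b); first by constructor 2.
constructor 3; case: IH => [E|yb|[w Pw]].
- by move: nzb; rewrite adj_sym -E yz.
- have Dyb := adj_neq yb; exists y.
  rewrite /P4 ab (adj_sym G b) yb yz (adj_sym G b) nzb andbT /=.
  apply/andP; split; apply/negP.
    by move=> ay; have E := Na _ ay; rewrite E eqxx in Dyb.
  by move=> az; have E := Na _ az; rewrite E eqxx in Dzb.
- have [_ bw wy _] := and4P Pw.
  have yw : G y w by rewrite adj_sym.
  have E := elimT (leafP yw) (P4_leaf_end Pw la) z yz.
  by move: nzb; rewrite E adj_sym bw.
Qed.

Lemma P4_mid_not_leaf a b c d : P4 a b c d -> ~~ leaf b.
Proof.
case/and4P=> ab bc cd /and3P[nac nad nbd].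
apply/(leafP bc) => /(_ a); rewrite adj_sym => /(_ ab) E.
by rewrite E cd in nad.
Qed.

(** Any other leaf at [b] would lie off the path, hence be adjacent to [c] too. *)
Lemma leaf_P4_mid a b c d l :
  P4 a b c d -> leaf a -> leaf l -> G l b -> l = a.
Proof.
move=> P la ll lb; apply: contraTeq isT => Dla.
case/and4P: (P) => ab bc cd /and3P[nac nad nbd].
have Nl : l \notin [:: a; b; c; d].
  rewrite !inE (negPf Dla) (negPf (adj_neq lb)) /= negb_or.
  apply/andP; split; last by apply: contraTneq lb => ->; rewrite adj_sym.
  by apply: contraTneq ll => ->; exact: P4_mid_not_leaf (P4_rev P).
have [E _] := P4_extension P Nl.
have /(elimT (leafP lb) ll) Ecb : G l c by rewrite -E.
by rewrite Ecb adj_irr in bc.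
Qed.

Lemma leaf_P4_degree a b c d :
  P4 a b c d -> leaf a -> #|G b| = #|V| - #|[set v | leaf v]|.
Proof.
move=> P la; case/and4P: (P) => ab bc cd /and3P[nac nad nbd].
have ba : G b a by rewrite adj_sym.
have nlb := P4_mid_not_leaf P.
rewrite card_sub_setC; set N := ~: _.
have bN : b \in N by rewrite !inE.
(* The neighbours of [b] are the non-leaves with [b] replaced by [a]. *)
rewrite (cardsD1 b N) bN -[nat_of_bool _](cards1 a) -cardsUI.
have -> : [set a] :&: (N :\ b) = set0.
  by apply/setP => x; rewrite !inE; case: eqP => // ->; rewrite la andbF.
rewrite cards0 addn0; apply: eq_card => x; rewrite !inE -[x \in G b]/(G b x).
have [->|Dxa] := eqVneq x a; first by rewrite ba.
rewrite (adj_sym G b).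
have [->|Dxb] /= := eqVneq x b; first by rewrite adj_irr.
apply/idP/idP => [xb | nlx].
  by apply: contraNN Dxa => lx; apply/eqP; exact: leaf_P4_mid P la lx xb.
case: (leaf_P4_reach x P la) => [E|//|[y Py]]; first by rewrite E eqxx in Dxb.
by rewrite (P4_leaf_end Py la) in nlx.
Qed.

(** Sending each leaf to its neighbour is a bijection onto the vertices of degree [#|V| - L]. *)
Lemma leaf_P4_degree_count a b c d : P4 a b c d -> leaf a ->
  let L := #|[set v | leaf v]| in
  [/\ 0 < L, 1 < #|V| - L & #|[set v | #|G v| == #|V| - L]| = L].
Proof.
move=> P la L; case/and4P: (P) => ab bc cd /and3P[nac nad nbd].
have leaf_in l : leaf l -> exists k y z, P4 l k y z.
  move=> ll; case: (leaf_P4_reach l P la) => [E|lb|[y Py]].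
  - by move: ll; rewrite E (negPf (P4_mid_not_leaf P)).
  - by rewrite (leaf_P4_mid P la ll lb); exists b, c, d.
  - by exists y, b, a; exact: P4_rev.
have L0 : 0 < L by apply/card_gt0P; exists a; rewrite inE.
have nL : 1 < #|V| - L.
  rewrite /L card_sub_setC; apply/card_gt1P; exists b, c; rewrite !inE.
  by rewrite (P4_mid_not_leaf P) (P4_mid_not_leaf (P4_rev P)) (adj_neq bc).
split=> //; pose h l := odflt l [pick k | G l k].
have hP l k y z : leaf l -> P4 l k y z -> h l = k.
  move=> ll /and4P[lk _ _ _]; rewrite /h; case: pickP => [k' lk'|/(_ k)].
    exact: elimT (leafP lk) ll k' lk'.
  by rewrite lk.
have -> : [set v | #|G v| == #|V| - L] = h @: [set v | leaf v].
  apply/setP => v; rewrite inE; apply/eqP/imsetP => [dv | [l]].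
    have nlv : ~~ leaf v by rewrite /leaf dv; case: eqP nL => // ->.
    (* Without a leaf among its neighbours the non-leaf [v] would have degree below [#|V| - L]. *)
    have [l /andP[ll lv]] : exists l, leaf l && G l v.
      apply/existsP; apply: contraTT nL => /existsPn nl.
      have : #|G v| <= #|~: [set v | leaf v] :\ v|.
        apply: subset_leq_card; apply/subsetP => x; rewrite -[x \in G v]/(G v x) => vx.
        rewrite !inE eq_sym (adj_neq vx) /=; move: (nl x).
        by rewrite adj_sym vx andbT.
      rewrite dv /L card_sub_setC (cardsD1 v (~: _)) !inE nlv add1n.
      by rewrite ltnn.
    exists l; first by rewrite inE.
    have [k [y [z Pk]]] := leaf_in l ll.
    have lk : G l k by case/and4P: Pk.
    by rewrite (hP l k y z) // (elimT (leafP lk) ll v lv).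
  rewrite inE => ll ->; have [k [y [z Pk]]] := leaf_in l ll.
  by rewrite (hP l k y z ll Pk); exact: leaf_P4_degree Pk ll.
rewrite card_in_imset // => l l'; rewrite !inE => ll ll'.
have [k [y [z Pk]]] := leaf_in l ll; have [k' [y' [z' Pk']]] := leaf_in l' ll'.
rewrite (hP _ _ _ _ ll Pk) (hP _ _ _ _ ll' Pk') => E; subst k'.
by apply/esym/(leaf_P4_mid Pk ll ll'); case/and4P: Pk'.
Qed.

End P4Sparse.

(** * Tree 2-spanners *)

Section TreeSpanner.
Variables (V : finType) (G T : sgraph V).
Hypothesis spanT : tree_spanner 2 G T.

Let subTG : subrel T G. Proof. by case: spanT => [[]]. Qed.
Let connT x y : connect T x y. Proof. by case: spanT => [[_ []]]. Qed.
Let acyclicT c : 2 < size c -> ~ ucycle T c.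
Proof. by case: spanT => [[_ [_ +]] _]; apply. Qed.

Definition upath u p := path T u p && uniq (u :: p).

Lemma upath1 u v : T u v -> upath u [:: v].
Proof. by move=> uv; rewrite /upath /= uv inE (adj_neq uv). Qed.

(** Only immediate backtracking has to be excluded: a later return to [x] would close a cycle of
    [T]. For empty [p] the default turns the condition into [x != u], which the edge gives
    anyway. *)
Lemma upath_cons x u p : T x u -> x != head u p -> upath u p -> upath x (u :: p).
Proof.
move=> xu Dx /andP[pup up]; rewrite /upath /= xu pup -[_ && uniq p]/(uniq (u :: p)).
rewrite up andbT inE (negPf (adj_neq xu)) /=.
case: (boolP (x \in p)) => // xp; exfalso.
have Dp : p = take (index x p) p ++ x :: drop (index x p).+1 p.
  by rewrite -{2}(nth_index x xp) -drop_nth ?index_mem // cat_take_drop.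
case: (take _ _) Dp => [|y q] Dp; first by rewrite Dp eqxx in Dx.
apply: (@acyclicT (u :: rcons (y :: q) x)); first by rewrite /= size_rcons.
move: pup up; rewrite Dp -cat_rcons cat_path -cat_cons cat_uniq => /andP[pq _] /andP[uq _].
by rewrite /ucycle uq andbT [cycle _ _]rcons_path pq last_rcons xu.
Qed.

(** An edge of [G] between the ends would give a walk of length at most 2 in [T], which closes a
    cycle with the longer path. *)
Lemma upath_far u p : upath u p -> 2 < size p -> ~~ G u (last u p).
Proof.
move=> /andP[pup up] sp; apply/negP => /(proj2 spanT)[q []].
case: q => [|w [|v [|? ?]]] //=.
- move=> _ E _; case: p pup up sp E => //= y p _ /andP[ny _] _ E; move: ny.
  by rewrite {1}E -[_ \in _]/(_ \in y :: p) mem_last.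
- move=> /andP[uw _] E _; subst w; apply: (@acyclicT (u :: p)); first exact: ltnW.
  by rewrite /ucycle up andbT /= rcons_path pup adj_sym.
move=> /and3P[uw wv _] E _; subst v.
(* If [w] is off the path, it closes the whole path to a cycle. If [w] comes first on [p], then [p]
   itself closes up; if later, the edge from [u] to [w] closes the part up to [w]. *)
have [wp|nwp] := boolP (w \in p); last first.
  apply: (@acyclicT (u :: rcons p w)); first by rewrite /= size_rcons ltnS ltnW // ltnW.
  rewrite /ucycle -rcons_cons rcons_uniq up inE eq_sym (negPf (adj_neq uw)) nwp /=.
  by rewrite !rcons_path pup last_rcons (adj_sym T _ w) wv adj_sym uw.
have Dp : p = take (index w p) p ++ w :: drop (index w p).+1 p.
  by rewrite -{2}(nth_index w wp) -drop_nth ?index_mem // cat_take_drop.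
case: (take _ _) Dp => [|y q] Dp.
  apply: (@acyclicT p) => //; move: pup up wv; rewrite Dp /= => /andP[_ pw] /andP[_ uw'].
  by rewrite adj_sym => wv; rewrite /ucycle /= uw' andbT rcons_path pw.
apply: (@acyclicT (u :: rcons (y :: q) w)); first by rewrite /= size_rcons.
move: pup up; rewrite Dp -cat_rcons cat_path -cat_cons cat_uniq => /andP[pq _] /andP[uq _].
by rewrite /ucycle uq andbT [cycle _ _]rcons_path pq last_rcons adj_sym uw.
Qed.

Lemma upath_short c x : (forall x1 x2 x3, ~~ upath c [:: x1; x2; x3]) ->
  [\/ x = c, T c x | exists2 b, T c b & T b x].
Proof.
move=> Hc; have /connectP[p0 pp ->] := connT c x; case: (shortenP pp).
case=> [|x1 [|x2 [|x3 q]]] pq uq _; first by constructor 1.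
- by constructor 2; case/andP: pq.
- by constructor 3; case/and3P: pq => *; exists x1.
have /negP[] := Hc x1 x2 x3; have := take_path 3 pq; have := take_uniq 4 uq.
by rewrite /upath /= !take0 => -> ->.
Qed.

(** * Long tree paths in a P4-sparse graph *)

Hypothesis sparse : P4_sparse G.

Lemma upath_behead u v p : upath u (v :: p) -> T u v /\ upath v p.
Proof. by case/andP=> /= /andP[-> pp] /andP[_ up]; rewrite /upath pp. Qed.

Lemma upath_cat u p q : upath u (p ++ q) -> upath u p.
Proof.
by rewrite /upath cat_path -cat_cons cat_uniq => /andP[/andP[-> _] /andP[->]].
Qed.

Lemma P4_ends a b c d x :
  P4 G a b c d -> uniq [:: x; a; b; c; d] -> G x a = G x d.
Proof. by move=> P /andP[Nx _]; have [] := P4_extension sparse P Nx. Qed.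

(** By [upath_far] the only possible chords are [ac], [bd] and [ce]. Each pattern excluded here
    leaves an induced P4 with exactly one end adjacent to the fifth vertex, against [P4_ends]. *)
Lemma upath4_chords a b c d e : upath a [:: b; c; d; e] ->
  G a c = G c e /\ (G a c || G b d).
Proof.
move=> P; have nae := upath_far P isT.
have nad := upath_far (upath_cat (p := [:: b; c; d]) P) isT.
have [/subTG ab P'] := upath_behead P; have nbe := upath_far P' isT.
case/andP: P => /and5P[_ /subTG bc /subTG cd /subTG de _] U.
rewrite /= in nae nad nbe.
have symG := adj_sym G.
have H1 : G a c || G b d.
  apply: contraNT nae => /norP[nac nbd].
  have Pa : P4 G a b c d by rewrite /P4 ab bc cd nac nad nbd.
  by rewrite symG (P4_ends Pa) 1?symG // -(rot_uniq 1).
have H2 : G b d || G c e.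
  apply: contraNT nae => /norP[nbd nce].
  have Pb : P4 G b c d e by rewrite /P4 bc cd de nbd nbe nce.
  by rewrite -(P4_ends Pb) // symG.
split=> //; have [ac|nac] := boolP (G a c); have [ce|nce] := boolP (G c e) => //.
- have Pa : P4 G a c d e by rewrite /P4 ac cd de nad nae nce.
  have := P4_ends (x := b) Pa; rewrite (symG b a) ab (negPf nbe); apply.
  by rewrite (perm_uniq (permEl (perm_catCA [:: b] [:: a] [:: c; d; e]))).
- have bd : G b d by move: H1; rewrite (negPf nac).
  have Pa : P4 G a b c e by rewrite /P4 ab bc ce nac nae nbe.
  have := P4_ends (x := d) Pa; rewrite (symG d a) de (negPf nad) => -> //.
  by rewrite (perm_uniq (permEl (perm_catCA [:: d] [:: a; b; c] [:: e]))).
Qed.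

(** The chords found on the two subpaths of length 4 make [a c e f] or [a b d f] an induced P4; then
    [b], respectively [e], is adjacent to just one of its ends. *)
Lemma upath5_absurd a b c d e f : ~~ upath a [:: b; c; d; e; f].
Proof.
apply/negP => P; have symG := adj_sym G.
have [/subTG ab P'] := upath_behead P; have [/subTG bc P''] := upath_behead P'.
have /= naf := upath_far P isT; have /= nbf := upath_far P' isT.
have /= ncf := upath_far P'' isT.
have Q := upath_cat (p := [:: b; c; d; e]) P.
have /= nae := upath_far Q isT.
have /= nad := upath_far (upath_cat (p := [:: b; c; d]) P) isT.
have [Eac Dac] := upath4_chords Q; have [Ebd _] := upath4_chords P'.
case/andP: P'' => /= /and4P[/subTG cd /subTG de /subTG ef _] _.
case/andP: P => _ U; have [ac|nac] := boolP (G a c).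
  have Pa : P4 G a c e f by rewrite /P4 -Eac ac ef nae naf ncf.
  have := P4_ends (x := b) Pa; rewrite (symG b a) ab (negPf nbf) => /(_ _)/esym H.
  have /H // : uniq [:: b; a; c; e; f].
  move: U; rewrite (perm_uniq (permEl (perm_catCA [:: a] [:: b] [:: c; d; e; f]))).
  by apply/subseq_uniq/subseqP; exists [:: true; true; true; false; true; true].
have bd : G b d by rewrite (negPf nac) in Dac.
have Pa : P4 G a b d f by rewrite /P4 ab bd -Ebd bd nad naf nbf.
have := P4_ends (x := e) Pa; rewrite (symG e a) ef (negPf nae) => H.
have /H // : uniq [:: e; a; b; d; f].
move: U; rewrite (perm_uniq (permEl (perm_catCA [:: a; b; c; d] [:: e] [:: f]))).
by apply/subseq_uniq/subseqP; exists [:: true; true; true; false; true; true].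
Qed.

(** The center is the middle of a path of length 4, failing that an inner vertex of a path of length
    3, failing that any vertex. A path of length 3 from it could be prolonged to a forbidden
    length. *)
Lemma exists_center (x0 : V) : exists c, forall x1 x2 x3, ~~ upath c [:: x1; x2; x3].
Proof.
have neq2 u v w p : upath u [:: v, w & p] -> u != w.
  by case/andP=> _ /andP[]; rewrite !inE !negb_or => /and3P[].
case: (pickP (fun w => let: (a, b, c, d, e) := w in upath a [:: b; c; d; e])).
  move=> [[[[a b] c] d] e] P; exists c => x1 x2 x3; apply/negP => Q.
  have [ab P1] := upath_behead P; have [bc P2] := upath_behead P1.
  have [cd P3] := upath_behead P2; have [de _] := upath_behead P3.
  (* A path leaving [c] through [b] is prolonged backwards by [d] and [e], any other one by [b] and
     [a]. *)
  have [Ex|Dx] := eqVneq b x1.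
    have Dx : d != x1 by rewrite -Ex eq_sym (neq2 _ _ _ _ P1).
    have /negP[] := upath5_absurd e d c x1 x2 x3.
    apply: upath_cons; [by rewrite adj_sym | by rewrite eq_sym (neq2 _ _ _ _ P2)|].
    by apply: upath_cons; rewrite // adj_sym.
  have /negP[] := upath5_absurd a b c x1 x2 x3.
  apply: upath_cons ab _ _; first exact: neq2 P.
  by apply: upath_cons.
move=> no4; case: (pickP (fun w => let: (a, b, c, d) := w in upath a [:: b; c; d])).
  move=> [[[a b] c] d] P; exists b => x1 x2 x3; apply/negP => Q.
  have [ab P1] := upath_behead P; have [bc _] := upath_behead P1.
  have [Ex|Dx] := eqVneq c x1.
    have := no4 (a, b, x1, x2, x3); rewrite upath_cons //= -Ex.
    exact: neq2 P.
  by have := no4 (c, b, x1, x2, x3); rewrite upath_cons // adj_sym.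
by move=> no3; exists x0 => x1 x2 x3; rewrite (no3 (x0, x1, x2, x3)).
Qed.

Lemma leaf_P4_exists (x0 : V) :
    (forall v, exists2 w, w != v & ~~ G v w) ->
  exists a b c d, P4 G a b c d /\ leaf G a.
Proof.
move=> no_univ; have [c cc] := exists_center x0; have symG := adj_sym G.
have level x := upath_short x cc.
have [a Dac nca] := no_univ c; have [E|ca|[b cb ba]] := level a.
- by rewrite E eqxx in Dac.
- by rewrite (subTG ca) in nca.
have bc : T b c by rewrite adj_sym.
have ab : T a b by rewrite adj_sym.
have nac : ~~ G a c by rewrite symG.
have far3 x y z : T c x -> T x y -> y != c -> T c z -> z != x -> ~~ G y z.
  move=> cx xy Dyc cz Dzx; apply: (@upath_far y [:: x; c; z]) => //.
  apply: upath_cons; [by rewrite adj_sym | exact: Dyc|].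
  apply: upath_cons; [by rewrite adj_sym | by rewrite eq_sym|exact: upath1].
have up4 x y z t : T c x -> T x y -> y != c -> T c z -> T z t -> t != c -> z != x ->
    upath y [:: x; c; z; t].
  move=> cx xy Dyc cz zt Dtc Dzx.
  apply: upath_cons; [by rewrite adj_sym | exact: Dyc|].
  apply: upath_cons; [by rewrite adj_sym | by rewrite eq_sym|].
  by apply: upath_cons; rewrite // 1?eq_sym // upath1.
(* A neighbour of [a] other than [b] must be a child of [b]: apart from [c], all other vertices are
   at tree distance at least 3 from [a]. Being adjacent to the end [a] it is adjacent to the end
   [q], which is excluded. *)
have leaf_a p q : P4 G a b p q -> ~~ G b q ->
    (forall x, T b x -> x != c -> ~~ G x q) -> leaf G a.
  move=> P nbq nxq; apply/(leafP (subTG ab)) => x ax.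
  apply: contraTeq isT => Dxb.
  have Dxc : x != c by apply: contraTneq ax => ->.
  have [E|cx|[b' cb' b'x]] := level x; first by rewrite E eqxx in Dxc.
    by move: (far3 b a x cb ba Dac cx Dxb); rewrite ax.
  have [E|Db'b] := eqVneq b' b; last first.
    have := upath_far (up4 b a b' x cb ba Dac cb' b'x Dxc Db'b) isT.
    by rewrite /= ax.
  subst b'; have := nxq x b'x Dxc; rewrite -(P4_ends (x := x) P) ?(symG x a) ?ax //.
  rewrite cons_uniq (P4_uniq P) andbT.
  have [_ _ pq /and3P[nap _ _]] := and4P P.
  rewrite !inE (eq_sym x a) (negPf (adj_neq ax)) (negPf Dxb) /=.
  apply/norP; split; first by apply: contraNneq nap => <-.
  by apply: contraNneq nbq => <-; exact: subTG.
(* If [z] is a child of [c], the induced path is [a b c z]. If [z] is a child of another child [d]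
   of [c], it is [a b d z]: as the chord [ac] is missing, [upath4_chords] provides [bd]. *)
have [z Dzb nbz] := no_univ b; have [E|cz|[d cd dz]] := level z.
- by rewrite E (subTG bc) in nbz.
- have naz := far3 b a z cb ba Dac cz Dzb.
  have P : P4 G a b c z by rewrite /P4 (subTG ab) (subTG bc) (subTG cz) nac naz.
  exists a, b, c, z; split=> //; apply: leaf_a P nbz _ => x bx Dxc.
  exact: far3 cb bx Dxc cz Dzb.
have Ddb : d != b by apply: contraNneq nbz => <-; exact: subTG.
have Dzc : z != c by apply: contraNneq nbz => ->; exact: subTG.
have W := up4 b a d z cb ba Dac cd dz Dzc Ddb.
have [_] := upath4_chords W; rewrite (negPf nac) /= => bd.
have /= naz := upath_far W isT.
have nad := far3 b a d cb ba Dac cd Ddb.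
have P : P4 G a b d z by rewrite /P4 (subTG ab) bd (subTG dz) nad naz.
exists a, b, d, z; split=> //; apply: leaf_a P nbz _ => x bx Dxc.
exact: upath_far (up4 b x d z cb bx Dxc cd dz Dzc Ddb) isT.
Qed.

End TreeSpanner.

(** * The degree criterion *)

Section Criterion.
Variables (V : finType) (G : sgraph V).

(** * A tree 2-spanner around a hub *)

Section Hub.
Variable v : V.
Hypothesis hub : forall w, w != v ->
  G w v \/ leaf G w /\ exists2 u, G w u & G u v.

Definition hub_rel : rel V :=
  fun x y => G x y && [|| x == v, y == v, leaf G x | leaf G y].

Lemma hub_sym : symmetric hub_rel.
Proof. by move=> x y; rewrite /hub_rel adj_sym orbCA (orbC (leaf G x)). Qed.

Lemma hub_irr : irreflexive hub_rel.
Proof. by move=> x; rewrite /hub_rel adj_irr. Qed.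

Definition hub_tree := SGraph hub_sym hub_irr.

(** A vertex on a cycle has two neighbours, so it is not a leaf; hence every edge of the cycle would
    have to contain [v]. *)
Lemma hub_acyclic c : 2 < size c -> ~ ucycle hub_tree c.
Proof.
have rot3 d x : 2 < size d -> ucycle hub_tree d -> x \in d ->
    exists y z s, ucycle hub_tree [:: x, y, z & s] /\ {subset [:: x, y, z & s] <= d}.
  move=> sd ud /rot_to[i p Dp].
  have : size (rot i d) = size d by rewrite size_rot.
  rewrite Dp; case: p Dp => [|y [|z s]] Dp E; rewrite -?E // in sd.
  by exists y, z, s; rewrite -Dp rot_ucycle; split=> // w; rewrite mem_rot.
have not_leaf d x : 2 < size d -> ucycle hub_tree d -> x \in d -> ~~ leaf G x.
  move=> sd ud /(rot3 _ _ sd ud)[y [z [s [/andP[+ uq] _]]]].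
  rewrite [cycle _ _]rcons_path => /andP[/andP[/andP[xy _] _] /andP[lx _]].
  apply/(leafP xy) => /(_ (last z s)).
  rewrite adj_sym lx => /(_ isT) E.
  by case/and3P: uq => _; rewrite -E mem_last.
have edge_hub d x y : 2 < size d -> ucycle hub_tree d -> x \in d -> y \in d ->
    hub_tree x y -> (x == v) || (y == v).
  move=> sd ud xd yd /andP[_].
  by rewrite (negPf (not_leaf d x sd ud xd)) (negPf (not_leaf d y sd ud yd)) !orbF.
move=> sc uc; have : v \in c.
  case: c sc uc => [|x [|y s]] // sc uc; rewrite !inE.
  have xy : hub_tree x y by case/andP: uc => /andP[].
  have := edge_hub _ x y sc uc; rewrite !inE !eqxx !orbT => /(_ isT isT xy).
  by rewrite !(eq_sym v) orbA => ->.
(* With the cycle rotated to start at [v], the edge from its second to its third vertex avoids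
   [v]. *)
move=> /(rot3 _ _ sc uc)[x [y [s [uc' sub]]]].
have xy : hub_tree x y by case/andP: uc' => /= /and3P[].
have := edge_hub _ x y sc uc; rewrite !sub ?inE ?eqxx ?orbT // => /(_ isT isT xy).
case/andP: uc' => _ /=; rewrite !inE !negb_or => /andP[/and3P[Dx Dy _] _].
by rewrite !(eq_sym _ v) (negPf Dx) (negPf Dy).
Qed.

Lemma hub_admissible : admissible 2 G.
Proof.
exists hub_tree; have subG : subrel hub_tree G by move=> x y /andP[].
have vw w : connect hub_tree w v.
  have [->|Dw] := eqVneq w v; first exact: connect0.
  case: (hub Dw) => [wv|[lw [u wu uv]]].
    by apply: connect1; rewrite /= /hub_rel wv eqxx orbT.
  apply: (connect_trans (y := u)); apply: connect1; rewrite /= /hub_rel.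
    by rewrite wu lw !orbT.
  by rewrite uv eqxx orbT.
split; [split=> //; split=> [x y|]|move=> x y xy].
- by apply: connect_trans (vw x) _; rewrite (sym_connect_sym hub_sym).
- exact: hub_acyclic.
have [Txy|] := boolP (hub_tree x y); first by exists [:: y]; rewrite //= andbT.
rewrite /= /hub_rel xy /= !negb_or => /and4P[Dx Dy nx ny].
(* An edge outside the tree joins two non-leaves other than [v]; both are adjacent to [v]. *)
exists [:: v; y]; split=> //=; rewrite /hub_rel !eqxx !orbT !andbT.
case: (hub Dx) (hub Dy) => [->|[lx]]; last by rewrite lx in nx.
by case=> [|[ly]]; [rewrite adj_sym | rewrite ly in ny].
Qed.

End Hub.

Definition deg_count (d : nat) : nat := #|[set v | #|G v| == d]|.

(** The null graph has its own disjunct: it is admissible, but has no vertex whose degree could be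
    counted. *)
Definition criterion : bool :=
  let L := deg_count 1 in
  [|| #|V| == 0, 0 < deg_count #|V|.-1
    | [&& 0 < L, 1 < #|V| - L & deg_count (#|V| - L) == L]].

Lemma full_degree_adj v w : #|G v| = #|V|.-1 -> w != v -> G v w.
Proof.
move=> dv Dw; apply: contraT => nvw.
have : #|G v| <= #|[set: V] :\ v :\ w|.
  apply: subset_leq_card; apply/subsetP => x vx; rewrite !inE.
  by rewrite [x == v]eq_sym (adj_neq vx) !andbT; apply: contraNneq nvw => <-.
have := cardsD1 w ([set: V] :\ v); have := cardsD1 v [set: V].
rewrite cardsT dv !inE Dw /=; lia.
Qed.

(* Let K be the set of the L vertices of degree n - L.  A vertex of K has at most
   n - L - 1 neighbours that are not leaves, hence a neighbour that is a leaf.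
   There are as many leaves as vertices in K and each leaf has one neighbour, so
   leaves and vertices of K are matched, and each vertex of K is adjacent to all
   the other vertices that are not leaves. *)
Lemma degree_count_hub (L := deg_count 1) :
    0 < L -> 1 < #|V| - L -> deg_count (#|V| - L) = L ->
  exists v, forall w, w != v -> G w v \/ leaf G w /\ exists2 u, G w u & G u v.
Proof.
move=> L0 nL EK; pose lv := [set v | leaf G v]; pose K := [set v | #|G v| == #|V| - L].
have EL : #|lv| = L by [].
clearbody L.
have h0 l : leaf G l -> exists k, G l k.
  move=> /eqP ll; have /card_gt0P[k lk] : 0 < #|G l| by rewrite ll.
  by exists k.
pose h l := odflt l [pick k | G l k].
have hP l : leaf G l -> G l (h l).
  move=> ll; rewrite /h; case: pickP => //= nk; have [k lk] := h0 l ll.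
  by rewrite nk in lk.
have hE l k : leaf G l -> G l k -> k = h l.
  by move=> ll lk; apply: (elimT (leafP (hP l ll)) ll).
have nlK k : k \in K -> ~~ leaf G k.
  by rewrite inE /leaf => /eqP->; move: nL; case: (_ - _) => [|[]].
have split_deg k : k \in K ->
    #|V| - L <= #|[set l in lv | G k l]| + #|[set l in ~: lv | G k l]|.
  move=> kK; have := kK; rewrite inE => /eqP<-; rewrite -cardsUI.
  apply: leq_trans (leq_addr _ _); apply: subset_leq_card; apply/subsetP => x kx.
  by rewrite !inE -[G k x]/(x \in G k) kx !andbT; case: leaf.
have nonleaf_nbrs k : k \in K -> [set l in ~: lv | G k l] \subset ~: lv :\ k.
  move=> kK; apply/subsetP => x; rewrite !inE => /andP[-> kx].
  by rewrite eq_sym (adj_neq kx).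
have card_nl k : k \in K -> #|~: lv :\ k| = (#|V| - L).-1.
  by move=> kK; rewrite -EL card_sub_setC [in RHS](cardsD1 k) !inE nlK.
have has_leaf k : k \in K -> exists2 l, leaf G l & G k l.
  move=> kK; have := subset_leq_card (nonleaf_nbrs k kK); rewrite card_nl // => H.
  have : 0 < #|[set l in lv | G k l]| by have := split_deg k kK; lia.
  by case/card_gt0P=> l; rewrite !inE => /andP[]; exists l.
have KS : K \subset h @: lv.
  apply/subsetP => k kK; have [l ll kl] := has_leaf k kK.
  apply/imsetP; exists l; first by rewrite inE.
  by apply: hE; rewrite // adj_sym.
have cK : #|K| = #|lv| by rewrite EL.
have EhK : K = h @: lv.
  by apply/eqP; rewrite eqEcard KS cK leq_imset_card.
have injh : {in lv &, injective h} by apply/imset_injP; rewrite -EhK cK.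
have [v vK] : exists v, v \in K by apply/card_gt0P; rewrite cK EL.
exists v => w Dw; have hubK k : ~~ leaf G k -> k != v -> G k v.
  move=> nk Dk; have H : [set l in ~: lv | G v l] = ~: lv :\ v.
    apply/eqP; rewrite eqEcard nonleaf_nbrs // card_nl //.
    have : #|[set l in lv | G v l]| <= 1.
      apply/card_le1_eqP => l l'; rewrite !inE => /andP[ll vl] /andP[ll' vl'].
      apply: injh; rewrite ?inE //.
      have <- : v = h l by apply: hE; rewrite // adj_sym.
      by apply/esym/hE; rewrite // adj_sym.
    by have := split_deg v vK; lia.
  by have: k \in ~: lv :\ v; [rewrite !inE Dk nk | rewrite -H !inE adj_sym => /andP[]].
have [lw|nlw] := boolP (leaf G w); last by left; exact: hubK.
have [E|Dh] := eqVneq (h w) v; first by left; rewrite -E hP.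
(* The neighbour of a leaf lies in [K], so it is a non-leaf and, being distinct from [v], adjacent
   to [v]. *)
right; split=> //; exists (h w); first exact: hP.
apply: hubK => //; apply: nlK; rewrite EhK.
by apply: imset_f; rewrite inE.
Qed.

Lemma criterionP : P4_sparse G -> reflect (admissible 2 G) criterion.
Proof.
move=> sparse; apply: (iffP or3P) => [[/eqP V0|full|/and3P[L0 nL /eqP EK]]|[T spanT]].
- have no (x : V) : False by have := max_card (pred1 x); rewrite V0 card1.
  by exists G; split=> [|x]; [split=> //; split=> [x|[|x s]] | ] => //; case: (no x).
- have /card_gt0P[v] := full; rewrite inE => /eqP dv.
  by apply: (@hub_admissible v) => w Dw; left; rewrite adj_sym full_degree_adj.
- by have [v hubv] := degree_count_hub L0 nL EK; exact: hub_admissible hubv.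
have [/eqP|/card_gt0P[x0 _]] := posnP #|V|; first by constructor 1.
have [/existsP[v /forallP full]|/existsPn nfull] :=
  boolP [exists v, forall w, (w != v) ==> G v w].
  constructor 2; apply/card_gt0P; exists v; rewrite inE -(cardsC1 v).
  apply/eqP; rewrite -cardsE; congr #|pred_of_set _|.
  apply/setP => w; rewrite !inE; apply/idP/idP => [vw|Dw].
    by rewrite eq_sym (adj_neq vw).
  by have := full w; rewrite Dw.
constructor 3.
have [a [b [c [d [P la]]]]] : exists a b c d, P4 G a b c d /\ leaf G a.
  apply: (leaf_P4_exists spanT sparse x0) => v.
  have := nfull v; rewrite negb_forall => /existsP[w]; rewrite negb_imply.
  by case/andP; exists w.
have connG x y : connect G x y.
  case: spanT => [[sTG [conT _]] _].
  by apply: connect_sub (conT x y) => u w uw; exact/connect1/sTG.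
have [L0 nL EK] := leaf_P4_degree_count sparse connG P la.
by apply/and3P; split=> //; apply/eqP.
Qed.

End Criterion.

(** * The program *)

Arguments run : simpl never.

(** * Execution of single instructions *)

Section Run.
Variables (W : nat) (p : program) (t q : nat) (R : nat -> nat) (m : nat -> nat).

Lemma run_Const r k : onth p q = Some (Const r k) -> k < W ->
  run W p t.+1 (Config q R m) = run W p t (Config q.+1 [eta R with r |-> k] m).
Proof. by rewrite /run /= => -> /= lt; rewrite /set_reg lt. Qed.

Lemma run_Add r a b : onth p q = Some (Add r a b) -> R a + R b < W ->
  run W p t.+1 (Config q R m) =
    run W p t (Config q.+1 [eta R with r |-> R a + R b] m).
Proof. by rewrite /run /= => -> /= lt; rewrite /set_reg lt. Qed.

Lemma run_Sub r a b : onth p q = Some (Defs.Sub r a b) -> R a - R b < W ->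
  run W p t.+1 (Config q R m) =
    run W p t (Config q.+1 [eta R with r |-> R a - R b] m).
Proof. by rewrite /run /= => -> /= lt; rewrite /set_reg lt. Qed.

Lemma run_Fetch r a : onth p q = Some (Fetch r a) -> m (R a) < W ->
  run W p t.+1 (Config q R m) =
    run W p t (Config q.+1 [eta R with r |-> m (R a)] m).
Proof. by rewrite /run /= => -> /= lt; rewrite /set_reg lt. Qed.

Lemma run_JumpZ r l : onth p q = Some (JumpZ r l) ->
  run W p t.+1 (Config q R m) =
    run W p t (Config (if R r == 0 then l else q.+1) R m).
Proof. by rewrite /run /= => ->. Qed.

Lemma run_Halt b : onth p q = Some (Halt b) ->
  run W p t.+1 (Config q R m) = Some b.
Proof. by rewrite /run /= => ->. Qed.

End Run.

(* Registers: 0 and 1 hold the constants 0 and 1, register 2 holds n and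
   register 3 the degree d to be counted.  Register 4 runs down from n to 1; its
   value j stands for the vertex j - 1, whose degree is memory[j + 1] - memory[j].
   As 1 - |deg - d| is the truth value of deg = d, no branching is needed to
   update the count, held in register 5. *)
Definition count_code (b : nat) : program :=
  [:: Add 4 2 0; Const 5 0; JumpZ 4 (14 + b); Fetch 6 4; Add 7 4 1; Fetch 7 7;
      Defs.Sub 4 4 1; Defs.Sub 7 7 6; Defs.Sub 6 7 3; Defs.Sub 7 3 7;
      Add 7 7 6; Defs.Sub 7 1 7; Add 5 5 7; JumpZ 0 (2 + b)].

Lemma eqn_sub1_dist (x y : nat) : 1 - (y - x + (x - y)) = (x == y).
Proof. case: eqP => [->|]; lia. Qed.

(** The time is two initialising instructions, twelve per vertex and the final test; the arbitrary
    remainder [t] lets runs be chained. *)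
Lemma count_code_run W p b n R m :
    (forall k, k < 14 -> onth p (k + b) = onth (count_code b) k) ->
    (forall i, i < n.+2 -> m i < W) -> n.+2 < W -> R 3 < W ->
    R 0 = 0 -> R 1 = 1 -> R 2 = n ->
  exists R',
    [/\ forall t, run W p (3 + 12 * n + t) (Config b R m) =
                    run W p t (Config (14 + b) R' m),
        R' 5 = \sum_(0 <= v < n) (m v.+2 - m v.+1 == R 3) &
        forall r, r \notin [:: 4; 5; 6; 7] -> R' r = R r].
Proof.
move=> code mW nW R3 R0 R1 R2.
have code_at q k : q = k + b -> k < 14 -> onth p q = onth (count_code b) k.
  by move=> ->; exact: code.
(* Loop invariant: [j] vertices are still to be treated; the bound on register 5 keeps the count
   below [W]. *)
suff loop j R1' : j <= n -> R1' 4 = j -> R1' 5 <= n - j ->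
    (forall r, r \notin [:: 4; 5; 6; 7] -> R1' r = R r) ->
  exists R',
    [/\ forall t, run W p (1 + 12 * j + t) (Config b.+2 R1' m) =
                    run W p t (Config (14 + b) R' m),
        R' 5 = R1' 5 + \sum_(0 <= v < j) (m v.+2 - m v.+1 == R 3) &
        forall r, r \notin [:: 4; 5; 6; 7] -> R' r = R r].
  pose R1' := [eta [eta R with 4 |-> R 2 + R 0] with 5 |-> 0].
  have [||||R' [runR' R'5 R'r]] := loop n R1'; rewrite ?leqnn //.
  - by rewrite /= R2 R0 addn0.
  - by move=> r; rewrite !inE !negb_or /= => /and4P[/negPf-> /negPf-> _ _].
  exists R'; split=> // t; rewrite -runR'.
  rewrite (run_Add _ _ (code_at b 0 erefl isT)); last by lia.
  by rewrite (run_Const _ _ _ (code_at b.+1 1 erefl isT)) //; lia.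
elim: j R1' => [|j IH] R1' lejn R4 R5 Rr.
  exists R1'; split=> //; last by rewrite big_nil addn0.
  by move=> t; rewrite muln0 (run_JumpZ _ _ _ _ (code_at b.+2 2 erefl isT)) R4.
have dm := mW j.+1 ltac:(lia); have dm' := mW j.+2 ltac:(lia).
have E0 : R1' 0 = 0 by rewrite Rr.
have E1 : R1' 1 = 1 by rewrite Rr.
have E3 : R1' 3 = R 3 by rewrite Rr.
pose D := m j.+2 - m j.+1.
have [R2' [run2 R24 R25 R2r]] : exists R2',
    [/\ forall t, run W p (12 + t) (Config b.+2 R1' m) =
                   run W p t (Config b.+2 R2' m),
        R2' 4 = j, R2' 5 = R1' 5 + (D == R 3) &
        forall r, r \notin [:: 4; 5; 6; 7] -> R2' r = R1' r].
  eexists; split=> [t|||].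
  - rewrite (run_JumpZ _ _ _ _ (code_at b.+2 2 erefl isT)) R4 /=.
    rewrite (run_Fetch _ (code_at b.+3 3 erefl isT)); last by rewrite R4.
    rewrite (run_Add _ _ (code_at b.+4 4 erefl isT)) /=; last by rewrite R4 E1; lia.
    rewrite (run_Fetch _ (code_at b.+4.+1 5 erefl isT)) /=; last by rewrite R4 E1 addn1.
    rewrite (run_Sub _ _ (code_at b.+4.+2 6 erefl isT)) /=; last by rewrite R4 E1; lia.
    rewrite (run_Sub _ _ (code_at b.+4.+3 7 erefl isT)) /=; last by rewrite R4 E1 addn1; lia.
    rewrite (run_Sub _ _ (code_at b.+4.+4 8 erefl isT)) /=; last by rewrite R4 E1 addn1 E3; lia.
    rewrite (run_Sub _ _ (code_at b.+4.+4.+1 9 erefl isT)) /=; last by rewrite R4 E1 addn1 E3; lia.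
    rewrite (run_Add _ _ (code_at b.+4.+4.+2 10 erefl isT)) /=; last by rewrite R4 E1 addn1 E3; lia.
    rewrite (run_Sub _ _ (code_at b.+4.+4.+3 11 erefl isT)) /=; last by rewrite R4 E1 addn1 E3; lia.
    rewrite (run_Add _ _ (code_at b.+4.+4.+4 12 erefl isT)) /=; last by rewrite R4 E1 addn1 E3; lia.
    (* Register 0 holds 0, so this jump back to the loop test is always taken. *)
    rewrite (run_JumpZ _ _ _ _ (code_at b.+4.+4.+4.+1 13 erefl isT)) /= E0 /=.
    reflexivity.
  - by rewrite /= R4 E1 subn1.
  - by rewrite /= R4 E1 E3 addn1 eqn_sub1_dist.
  - move=> r; rewrite !inE !negb_or /= => /and4P[].
    by do 4![move/negPf->].
have [|||R' [runR' R'5 R'r]] := IH R2' _ R24.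
- by lia.
- by rewrite R25; case: (_ == _); lia.
- by move=> r Nr; rewrite R2r ?Rr.
exists R'; split=> // [t|]; last first.
  by rewrite R'5 R25 big_nat_recr //= -addnA [in RHS](addnC _ (D == _ : nat)).
by rewrite mulnS -runR' -run2; congr run; lia.
Qed.

(** * Degrees from the table of offsets *)

Section Layout.
Variables (n : nat) (G : sgraph 'I_n) (N : 'I_n -> seq 'I_n).
Hypothesis listN : forall v, uniq (N v) /\ N v =i G v.

Lemma layout_size : nth 0 (layout N) 0 = n.
Proof. by []. Qed.

Lemma layout_offset k : k <= n -> nth 0 (layout N) k.+1 = offset N k.
Proof.
move=> kn; rewrite /layout; set s := map _ (iota 0 n.+1).
have ss : size s = n.+1 by rewrite size_map size_iota.
have <- : nth 0 s k = offset N k by rewrite (nth_map 0) ?size_iota // nth_iota.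
by clearbody s; rewrite -cat_cons nth_cat /= ss ltnS ltnS kn.
Qed.

Lemma size_nbrs v : size (N v) = #|G v|.
Proof. by have [U E] := listN v; rewrite -(eq_card E); apply/esym/card_uniqP. Qed.

(** Each list has at most [n] entries; the bound ensures that table entries are words. *)
Lemma offset_le k : offset N k <= n * n.
Proof.
rewrite /offset big_mkcond -[X in X * _]card_ord -sum_nat_const; apply: leq_sum => u _.
by case: ifP => // _; rewrite size_nbrs; exact: leq_trans (max_card _) (eq_leq (card_ord n)).
Qed.

Lemma offsetS (v : 'I_n) : offset N v.+1 = offset N v + #|G v|.
Proof.
rewrite /offset (bigD1 v) //= addnC size_nbrs; congr (_ + _); apply: eq_bigl => u.
by rewrite ltnS leq_eqVlt -val_eqE /= andb_orl andbN /= ltn_neqAle andbC andbA andbb.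
Qed.

Lemma sum_degree_test (m := nth 0 (layout N)) d :
  \sum_(0 <= v < n) (m v.+2 - m v.+1 == d) = deg_count G d.
Proof.
rewrite big_mkord /deg_count -sum1_card [RHS]big_mkcond; apply: eq_bigr => v _.
by rewrite inE /m !layout_offset ?offsetS ?addKn // ltnW.
Qed.

Lemma deg_count_le d : deg_count G d <= n.
Proof. exact: leq_trans (max_card _) (eq_leq (card_ord n)). Qed.

End Layout.

(* Line 59 accepts and line 58 rejects; register 8 holds the number of leaves. *)
Definition spanner_program : program :=
  [:: Const 1 1; Fetch 2 0; JumpZ 2 59; Defs.Sub 3 2 1]
  ++ count_code 4
  ++ [:: Defs.Sub 6 1 5; JumpZ 6 59; Const 3 1]
  ++ count_code 21
  ++ [:: Add 8 5 0; JumpZ 8 58; Defs.Sub 3 2 8; Defs.Sub 6 3 1; JumpZ 6 58]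
  ++ count_code 40
  ++ [:: Defs.Sub 6 5 8; Defs.Sub 7 8 5; Add 6 6 7; JumpZ 6 59;
         Halt false; Halt true].

Lemma spanner_program_run W n (G : sgraph 'I_n) (N : 'I_n -> seq 'I_n) :
    (forall v, uniq (N v) /\ N v =i G v) -> n.+2 < W -> n * n < W ->
  run W spanner_program (60 * n.+1) (init (layout N)) = Some (criterion G).
Proof.
move=> listN nW n2W; set p := spanner_program; set m := nth 0 (layout N).
have mW i : i < n.+2 -> m i < W.
  case: i => [|i] lt; first by rewrite /m layout_size; lia.
  by rewrite /m layout_offset //; apply: leq_ltn_trans (offset_le listN _) n2W.
have cW d := deg_count_le G d.
have count b R d : (forall k, k < 14 -> onth p (k + b) = onth (count_code b) k) ->
    d < W -> R 3 = d -> [/\ R 0 = 0, R 1 = 1 & R 2 = n] ->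
  exists R', [/\ forall t, run W p (3 + 12 * n + t) (Config b R m) =
                             run W p t (Config (14 + b) R' m),
    R' 5 = deg_count G d, R' 8 = R 8 & [/\ R' 0 = 0, R' 1 = 1 & R' 2 = n]].
  move=> code dW E3 [R0 R1 R2]; rewrite -E3 in dW *.
  have [R' [runR' R'5 Rr]] := count_code_run code mW nW dW R0 R1 R2.
  exists R'; split; rewrite -?(sum_degree_test listN) ?R'5 ?(Rr 8) //.
  by split; rewrite Rr.
(* The time is split along the straight-line blocks and the three counting passes; the last summand
   covers the final block and slack. *)
have -> : 60 * n.+1 = 4 + (3 + 12 * n + (3 + (3 + 12 * n +
    (5 + (3 + 12 * n + (5 + (34 + 24 * n))))))) by lia.
rewrite /init -/m /criterion card_ord.
rewrite (@run_Const W p _ _ _ _ 1 1) //; last by lia.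
rewrite (@run_Fetch W p _ _ _ _ 2 0) //=; last exact: mW.
rewrite (@run_JumpZ W p _ _ _ _ 2 59) //= [m 0]layout_size.
case: eqP => [_|n0]; first by rewrite (@run_Halt W p _ _ _ _ true).
rewrite (@run_Sub W p _ _ _ _ 3 2 1) //=; last by lia.
set R1 := (X in Config 4 X m).
have [||||R1' [-> R1'5 _ [Z1 O1 N1]]] := count 4 R1 n.-1; rewrite /R1 //=.
- by do 14?case.
- by lia.
- by rewrite subn1.
rewrite (@run_Sub W p _ _ _ _ 6 1 5) //=; last by rewrite O1; lia.
rewrite (@run_JumpZ W p _ _ _ _ 6 59) //= O1 R1'5.
(* By truncation, 1 minus the count vanishes exactly when the count is positive. *)
case: posnP => [full0|fullp]; last first.
  by rewrite (_ : 1 - _ == 0) ?(@run_Halt W p _ _ _ _ true) //; lia.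
rewrite full0 /= (@run_Const W p _ _ _ _ 3 1) //=; last by lia.
set R2 := (X in Config 21 X m).
have [||||R2' [-> R2'5 _ [Z2 O2 N2]]] := count 21 R2 1; rewrite /R2 //=.
- by do 14?case.
- by lia.
set L := deg_count G 1 in R2'5 *; have LW : L <= n by exact: cW.
rewrite (@run_Add W p _ _ _ _ 8 5 0) //=; last by rewrite R2'5 Z2; lia.
rewrite (@run_JumpZ W p _ _ _ _ 8 58) //= R2'5 Z2 addn0.
case: posnP => [L0|Lp]; first by rewrite (@run_Halt W p _ _ _ _ false).
rewrite (@run_Sub W p _ _ _ _ 3 2 8) //=; last by rewrite N2; lia.
rewrite (@run_Sub W p _ _ _ _ 6 3 1) //=; last by rewrite N2; lia.
rewrite (@run_JumpZ W p _ _ _ _ 6 58) //= N2 O2.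
have [nL|nL] := ltnP 1 (n - L); last first.
  by rewrite (_ : n - L - 1 == 0) ?(@run_Halt W p _ _ _ _ false) //; lia.
rewrite (_ : (n - L - 1 == 0) = false) /=; last by lia.
set R3 := (X in Config 40 X m).
have [||||R3' [-> R3'5 R3'8 [Z3 O3 N3]]] := count 40 R3 (n - L); rewrite /R3 //=.
- by do 14?case.
- by lia.
rewrite /R3 /= in R3'8.
have KW := cW (n - L).
rewrite (@run_Sub W p _ _ _ _ 6 5 8) //=; last by rewrite R3'5 R3'8; lia.
rewrite (@run_Sub W p _ _ _ _ 7 8 5) //=; last by rewrite R3'5 R3'8; lia.
rewrite (@run_Add W p _ _ _ _ 6 6 7) //=; last by rewrite R3'5 R3'8; lia.
rewrite (@run_JumpZ W p _ _ _ _ 6 59) //= R3'5 R3'8.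
(* The two truncated differences of the counts both vanish exactly when the counts agree. *)
rewrite addn_eq0 !subn_eq0 -eqn_leq; case: eqP => _.
  by rewrite (@run_Halt W p _ _ _ _ true).
by rewrite (@run_Halt W p _ _ _ _ false).
Qed.

Theorem theorem3 :
  exists p : program,
    decides_in_linear_time p
      (fun (n : nat) (G : sgraph 'I_n) => P4_sparse G)
      (fun (n : nat) (G : sgraph 'I_n) => admissible 2 G).
Proof.
(* Exponent 3 puts both [n.+2] and the offset bound [n * n] below the word bound, also for
   [n = 0]. *)
exists spanner_program, 60, 3 => n G x sparse [N listN ->].
exists (criterion G); last by split=> /(criterionP sparse).
by apply: (spanner_program_run listN); rewrite !expnS expn0; nia.
Qed.
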